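(* Let $b\ge2$ be an integer. For $n\ge2$, let $T_{n-1}=X_1+\dots+X_{n-1}$ be the total number of carries (equivalently, descents) associated with $n$ independent uniformly random base-$b$ digits. Then $T_{n-1}$ has mean $(n-1)\left(\frac12-\frac1{2b}\right)$ and variance $\frac{n+1}{12}\left(1-\frac1{b^2}\right)$, and, normalized by its mean and variance, $T_{n-1}$ converges in distribution to a standard normal random variable as $n\to\infty$ (with $b$ fixed).
   Context: Let $B_1,\dots,B_n$ be independent and uniformly distributed on $\{0,1,\dots,b-1\}$ and let $X_i=1$ if $B_i>B_{i+1}$ (a descent at $i$) and $X_i=0$ otherwise, $1\le i\le n-1$. When a column of independent uniform base-$b$ digits $A_1,\dots,A_n$ is added one digit at a time with running remainders $B_i=A_1+\dots+A_i\bmod b$, the $B_i$ are independent uniform and there is a carry at $i$ (meaning $B_i+A_{i+1}\ge b$) if and only if $B_i>B_{i+1}$. *)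

(* Defs.v *)
From HB Require Import structures.
From mathcomp Require Import all_boot all_order all_algebra finmap.
From mathcomp Require Import all_classical all_reals all_analysis.
From mathcomp Require Import measurable_realfun.

Set Implicit Arguments.
Unset Strict Implicit.
Unset Printing Implicit Defensive.

Import Order.TTheory GRing.Theory Num.Theory.
Import numFieldNormedType.Exports.

Local Open Scope classical_set_scope.
Local Open Scope ring_scope.

Definition mutually_independent d d' (T : measurableType d)
    (T' : measurableType d') (R : realType) (P : probability T R)
    (D : set nat) (X : nat -> {RV P >-> T'}) : Prop :=
  forall S : {fset nat}, [set` S] `<=` D ->
  forall E : nat -> set T', (forall i, measurable (E i)) ->
    P (\bigcap_(i in [set` S]) X i @^-1` E i)
    = (\prod_(i <- S) P (X i @^-1` E i))%E.

Arguments mutually_independent {d d' T T' R} P D X.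

(* Only B 1, ..., B n are constrained; B 0 and B i for i > n are arbitrary. *)
Definition iid_uniform_digits (b n : nat) d (T : measurableType d)
    (R : realType) (P : probability T R) (B : nat -> {RV P >-> nat}) : Prop :=
  (forall i, (1 <= i <= n)%N -> forall k : nat,
     distribution P (B i) [set k] = (if (k < b)%N then b%:R^-1 else 0)%:E)
  /\ mutually_independent P [set i | (1 <= i <= n)%N] B.

Arguments iid_uniform_digits b n {d T R} P B.

Definition descent (x : nat -> nat) (i : nat) : bool := (x i > x i.+1)%N.

Definition num_descents (n : nat) (x : nat -> nat) : nat :=
  (\sum_(1 <= i < n) descent x i)%N.

Definition remainder (b : nat) (a : nat -> nat) (i : nat) : nat :=
  ((\sum_(1 <= j < i.+1) a j) %% b)%N.

(* [carry b a i]: adding the digit a i.+1 to the remainder of the first i digits. *)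
Definition carry (b : nat) (a : nat -> nat) (i : nat) : bool :=
  (remainder b a i + a i.+1 >= b)%N.

Definition num_carries (b n : nat) (a : nat -> nat) : nat :=
  (\sum_(1 <= i < n) carry b a i)%N.

Section random_digits.
Context d (T : measurableType d) (R : realType) (P : probability T R).
Variable B : nat -> {RV P >-> nat}.

Lemma measurable_fun_sumn (m n : nat) (f : nat -> T -> nat) :
  (forall i, measurable_fun setT (f i)) ->
  measurable_fun setT (fun w => \sum_(m <= i < n) f i w)%N.
Proof.
move=> mf; elim: (index_iota m n) => [|i s IHs].
  by under eq_fun do rewrite big_nil; exact: measurable_cst.
by under eq_fun do rewrite big_cons; exact: measurable_fun_addn.
Qed.

Definition rv_remainder (b i : nat) : T -> nat :=
  fun w => remainder b (fun j => B j w) i.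

Lemma measurable_rv_remainder (b i : nat) :
  measurable_fun setT (rv_remainder b i).
Proof.
apply: (@measurableT_comp _ _ _ _ _ _ (fun m => m %% b)%N) => //.
exact: measurable_fun_sumn.
Qed.

HB.instance Definition _ (b i : nat) :=
  isMeasurableFun.Build _ _ _ _ (rv_remainder b i)
    (measurable_rv_remainder b i).

Definition total_descents (n : nat) : T -> R :=
  fun w => (num_descents n (fun i => B i w))%:R.

Lemma measurable_total_descents (n : nat) :
  measurable_fun setT (total_descents n).
Proof.
apply: (@measurableT_comp _ _ _ _ _ _ (fun m : nat => m%:R : R)) => //.
apply: measurable_fun_sumn => i.
apply: (@measurableT_comp _ _ _ _ _ _ nat_of_bool) => //.
exact: measurable_fun_ltn.
Qed.

HB.instance Definition _ (n : nat) :=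
  isMeasurableFun.Build _ _ _ _ (total_descents n)
    (measurable_total_descents n).

End random_digits.

Section standardized.
Context d (T : measurableType d) (R : realType) (P : probability T R).
Variable X : {RV P >-> R}.

Definition standardized : T -> R :=
  fun w => (X w - fine 'E_P[X]) / Num.sqrt (fine 'V_P[X]).

Lemma measurable_standardized : measurable_fun setT standardized.
Proof. by apply: measurable_funM => //; exact: measurable_funB. Qed.

HB.instance Definition _ :=
  isMeasurableFun.Build _ _ _ _ standardized measurable_standardized.

End standardized.
Arguments standardized {d T R} P X.

(* The X n may live on different probability spaces. *)
Definition converges_in_distribution (R : realType)
    (d : nat -> measure_display) (T : forall n, measurableType (d n))
    (P : forall n, probability (T n) R) (X : forall n, {RV (P n) >-> R})
    (mu : probability (measurableTypeR R) R) : Prop :=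
  forall x : R, {for x, continuous (fun y : R => mu `]-oo, y]%classic)} ->
    cdf (X n) x @[n --> \oo] --> mu `]-oo, x]%classic.

Arguments converges_in_distribution {R d T} P X mu.

(* Main.v *)
Require Import Defs.
From HB Require Import structures.
From mathcomp Require Import all_boot all_order all_algebra finmap.
From mathcomp Require Import all_classical all_reals all_analysis.
From mathcomp Require Import measurable_realfun ring lra zify.

Set Implicit Arguments.
Unset Strict Implicit.
Unset Printing Implicit Defensive.

Import Order.TTheory GRing.Theory Num.Theory.
Import numFieldNormedType.Exports.

Local Open Scope classical_set_scope.
Local Open Scope ring_scope.

(* Writing the running remainders as [B], the sum [b * (number of descents) +
   (last letter) - (first letter)] grows at each step by [(B i.+1 - B i) mod
   b]. These increments are independent uniform digits whatever the first
   letter, so up to a bounded error [b * T] is a sum of iid digits.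

   The central limit theorem for that sum is Lindeberg's argument along the
   heat flow: [u t x = Phi ((c - x) / sqrt t)] solves [u_t = u_xx / 2], hence
   averaging [u t] over one centered digit of variance [v] is [u (t + v)] up
   to [O(t^-3/2)]. Starting from [t] much smaller than [n], [n] steps lead
   from a smoothed indicator function to [Phi (c / sqrt (t + n v))]. With [n -
   1 = r^16], taking [t = r^12] and thresholds shifted by [r^7], all error
   terms vanish as [r] tends to infinity.

   The mean and the variance come from conditioning on the first letter. *)

(** * Taylor remainders of orders one to three *)

Section taylor.
Variable R : realType.
Implicit Types (f : R -> R) (x h M : R).

(** All hypotheses are confined to the ball of radius [|h|] around [x], because [normal_cdf_rescale]
    has a bound on the derivative only near the base point. *)
Lemma ler_norm_MVT f f' M x h :
  (forall y, `|y - x| <= `|h| -> is_derive y 1 f (f' y)) ->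
  (forall y, `|y - x| <= `|h| -> `|f' y| <= M) ->
  `|f (x + h) - f x| <= M * `|h|.
Proof.
move=> df f'M.
have fc (y : R) : `|y - x| <= `|h| -> {for y, continuous f}.
  by move=> /df dfy; apply/differentiable_continuous/derivable1_diffP.
have [h0|h0] := leP 0 h.
- have hE : `|h| = h by rewrite ger0_norm.
  have near_x y : y \in `[x, x + h] -> `|y - x| <= `|h|.
    by rewrite in_itv/= hE => /andP[xy yh]; rewrite ger0_norm ?subr_ge0//; lra.
  have [|||c cx ->] := @MVT_segment _ f f' x (x + h); first by lra.
  + by move=> y yx; apply/df/near_x; apply: subset_itv_oo_cc.
  + by apply: continuous_in_subspaceT => y; rewrite inE => yx; apply/fc/near_x.
  + rewrite normrM addrAC subrr add0r ler_wpM2r//.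
    exact/f'M/near_x.
- have hE : `|h| = - h by rewrite ltr0_norm.
  have near_x y : y \in `[x + h, x] -> `|y - x| <= `|h|.
    by rewrite in_itv/= hE => /andP[xy yh]; rewrite ler0_norm ?subr_le0//; lra.
  have [|||c cx] := @MVT_segment _ f f' (x + h) x; first by lra.
  + by move=> y yx; apply/df/near_x; apply: subset_itv_oo_cc.
  + by apply: continuous_in_subspaceT => y; rewrite inE => yx; apply/fc/near_x.
  + rewrite distrC => ->; rewrite normrM opprD addrA subrr add0r normrN ler_wpM2r//.
    exact/f'M/near_x.
Qed.

(** Mean value theorem for [f] minus its tangent line, whose derivative [f1 y - f1 x] is itself at
    most [M * |h|] by the mean value theorem. Two such uses give [M] instead of the sharp
    [M / 2]. *)
Lemma taylor2 f f1 f2 M x h :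
  (forall y, `|y - x| <= `|h| -> is_derive y 1 f (f1 y)) ->
  (forall y, `|y - x| <= `|h| -> is_derive y 1 f1 (f2 y)) ->
  (forall y, `|y - x| <= `|h| -> `|f2 y| <= M) ->
  `|f (x + h) - f x - h * f1 x| <= M * h ^+ 2.
Proof.
move=> df df1 f2M.
pose g y := f y - (y - x) * f1 x.
pose g1 y := f1 y - f1 x.
have dg y : `|y - x| <= `|h| -> is_derive y 1 g (g1 y).
  move=> /df dfy; rewrite /g /g1.
  by apply: is_derive_eq; rewrite /= !scaler0 add0r subr0 /GRing.scale/= mulr1.
have -> : f (x + h) - f x - h * f1 x = g (x + h) - g x by rewrite /g; ring.
rewrite -(real_normK (num_real h)) expr2 mulrA; apply: (ler_norm_MVT dg) => y yh.
rewrite /g1 -{1}(subrK x y) (addrC _ x).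
have M0 : 0 <= M by apply: le_trans (f2M x _); rewrite ?subrr ?normr0.
apply: (@le_trans _ _ (M * `|y - x|)); last by rewrite ler_wpM2l.
by apply: (@ler_norm_MVT _ f2) => z /le_trans/(_ yh) zh; [exact: df1|exact: f2M].
Qed.

Lemma taylor3 f f1 f2 f3 M x h :
  (forall y, `|y - x| <= `|h| -> is_derive y 1 f (f1 y)) ->
  (forall y, `|y - x| <= `|h| -> is_derive y 1 f1 (f2 y)) ->
  (forall y, `|y - x| <= `|h| -> is_derive y 1 f2 (f3 y)) ->
  (forall y, `|y - x| <= `|h| -> `|f3 y| <= M) ->
  `|f (x + h) - f x - h * f1 x - h ^+ 2 / 2 * f2 x| <= M * `|h| ^+ 3.
Proof.
move=> df df1 df2 f3M.
pose g y := f y - (y - x) * f1 x - (y - x) ^+ 2 / 2 * f2 x.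
pose g1 y := f1 y - f1 x - (y - x) * f2 x.
have dg y : `|y - x| <= `|h| -> is_derive y 1 g (g1 y).
  move=> /df dfy; rewrite /g /g1.
  by apply: is_derive_eq; rewrite /= !scaler0 ?add0r ?subr0 /GRing.scale/=; field.
have -> : f (x + h) - f x - h * f1 x - h ^+ 2 / 2 * f2 x = g (x + h) - g x.
  by rewrite /g; field.
rewrite exprSr mulrA; apply: (ler_norm_MVT dg) => y yh.
have M0 : 0 <= M by apply: le_trans (f3M x _); rewrite ?subrr ?normr0.
apply: (@le_trans _ _ (M * `|y - x| ^+ 2)); last by rewrite ler_wpM2l// lerXn2r.
rewrite /g1 -{1}(subrK x y) (addrC _ x) real_normK ?num_real//.
by apply: (@taylor2 _ _ f3) => z /le_trans/(_ yh) zh;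
  [exact: df1|exact: df2|exact: f3M].
Qed.

End taylor.

(** * The normal distribution function and its derivatives *)

Section normal_cdf.
Variable R : realType.
Local Notation phi := (normal_pdf (0 : R) 1).

Definition normal_cdf (x : R) : R := fine (normal_prob (0 : R) 1 `]-oo, x]).
Local Notation Phi := normal_cdf.

Lemma normal_cdfE x : normal_prob (0 : R) 1 `]-oo, x] = (Phi x)%:E.
Proof. by rewrite fineK// fin_num_measure. Qed.

Lemma normal_cdf_ge0 x : 0 <= Phi x.
Proof. by rewrite -lee_fin -normal_cdfE. Qed.

Lemma normal_cdf_le1 x : Phi x <= 1.
Proof. by rewrite -lee_fin -normal_cdfE probability_le1. Qed.

Lemma normal_cdf_homo : {homo Phi : x y / x <= y}.
Proof.
move=> x y xy; rewrite -lee_fin -!normal_cdfE le_measure ?inE//.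
exact: subitvPr.
Qed.

(** The identity as a random variable: its cdf under the normal law is [Phi], so the general limits
    of cdfs at infinity apply. *)
Let idR : measurableTypeR R -> R := idfun.

#[local] HB.instance Definition _ :=
  @isMeasurableFun.Build _ _ _ _ idR (@measurable_id _ _ setT).

Lemma cvg_normal_cdfy : Phi x @[x --> +oo%R] --> (1 : R).
Proof.
apply: (@fine_cvg _ _ _ _ (fun x => normal_prob (0 : R) 1 `]-oo, x])).
exact: (@cvg_cdfy1 _ _ _ (normal_prob (0 : R) 1) idR).
Qed.

Lemma cvg_normal_cdfNy : Phi x @[x --> -oo%R] --> (0 : R).
Proof.
apply: (@fine_cvg _ _ _ _ (fun x => normal_prob (0 : R) 1 `]-oo, x])).
exact: (@cvg_cdfNy0 _ _ _ (normal_prob (0 : R) 1) idR).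
Qed.

Global Instance is_derive_normal_cdf (x : R) : is_derive x 1 Phi (phi x).
Proof.
have PhiE : Phi = (fun y => \int[lebesgue_measure]_(t in `]-oo, y]) phi t)%R.
  by [].
have int u : lebesgue_measure.-integrable `]-oo, u] (EFin \o phi).
  by apply: (integrableS _ _ (subsetT _)) => //; exact: integrable_normal_pdf.
(* The fundamental theorem of calculus on the half-line; [x + 1] merely provides a right endpoint
   beyond [x]. *)
have [dPhi eqPhi] := @continuous_FTC1 R phi -oo%O x (x + 1)
   (ltac:(by rewrite ltrDl)) (int _) (ltNyr x) (@continuous_normal_pdf R 0 1 (oner_neq0 R) x).
rewrite PhiE -eqPhi derive1E; exact: DeriveDef.
Qed.

Definition normal_pdf1 (x : R) := - (x * phi x).
Definition normal_pdf2 (x : R) := (x ^+ 2 - 1) * phi x.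

Lemma normal_pdf01E x : phi x = normal_peak 1 * expR (- (x ^+ 2 / 2)).
Proof.
by rewrite normal_pdfE ?oner_neq0// /normal_fun subr0 expr1n mulNr.
Qed.

Global Instance is_derive_normal_pdf (x : R) : is_derive x 1 phi (normal_pdf1 x).
Proof.
rewrite (_ : phi = (fun x => normal_peak 1 * expR (- (x ^+ 2 / 2)))); last first.
  by apply/funext => y; exact: normal_pdf01E.
apply: is_derive_eq.
by rewrite /normal_pdf1 normal_pdf01E /= !scaler0 ?add0r ?addr0 /GRing.scale/=; field.
Qed.

Global Instance is_derive_normal_pdf1 (x : R) : is_derive x 1 normal_pdf1 (normal_pdf2 x).
Proof.
apply: is_derive_eq.
by rewrite /normal_pdf2 /normal_pdf1 /GRing.scale/=; ring.
Qed.

(** With [y = x^2], [|x^k| <= 1 + y^2], while [exp (y/2) = exp (y/4)^2 >= (1 + y/4)^2]; the factor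
    17 makes the latter dominate the former. *)
Lemma normal_pdf_poly_bound : exists2 K : R, 0 < K &
  forall x k, (k <= 4)%N -> `|x ^+ k * phi x| <= K.
Proof.
exists (17 * normal_peak 1); first by rewrite mulr_gt0 ?normal_peak_gt0.
move=> x k k4; rewrite normrM (ger0_norm (normal_pdf_ge0 _ _ _)) normal_pdf01E.
rewrite mulrCA mulrC ler_wpM2r ?normal_peak_ge0//.
rewrite expRN ler_pdivrMr ?expR_gt0//.
have -> : x ^+ 2 / 2 = x ^+ 2 / 4 + x ^+ 2 / 4 :> R by field.
rewrite expRD.
have E1 : 1 + x ^+ 2 / 4 <= expR (x ^+ 2 / 4) by exact: expR_ge1Dx.
have x2 : 0 <= x ^+ 2 := sqr_ge0 x.
have xk : `|x ^+ k| <= 1 + x ^+ 4.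
  rewrite normrX; have [x1|x1] := leP `|x| 1.
    apply: (@le_trans _ _ 1); first exact: exprn_ile1.
    by rewrite (exprM x 2 2) lerDl sqr_ge0.
  apply: (@le_trans _ _ (`|x| ^+ 4)); first by rewrite ler_weXn2l// ltW.
  by rewrite -normrX ger0_norm ?(exprM x 2 2) ?sqr_ge0// lerDr.
apply: (le_trans xk); rewrite (exprM x 2 2).
move: x2 E1; set y := x ^+ 2; set E := expR _ => y0 E1.
apply: (@le_trans _ _ (17 * ((1 + y / 4) * (1 + y / 4)))); first by nra.
by rewrite ler_pM2l// ler_pM//; lra.
Qed.

End normal_cdf.

(** * The heat flow against one digit, then against a walk of digits *)

Section heat.
Variable R : realType.
Local Notation Phi := (@normal_cdf R).
Local Notation phi := (normal_pdf (0 : R) 1).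

(* With [u t x = Phi ((c - x) / sqrt t)], this is the comparison of [u (t + q
   t)] with its first order expansion in time; since [u] solves the heat
   equation, the time derivative is half the second space derivative. *)
Lemma normal_cdf_rescale (K z q : R) : 0 <= q <= 1 ->
  (forall x k, (k <= 4)%N -> `|x ^+ k * phi x| <= K) ->
  `|Phi (z / Num.sqrt (1 + q)) - Phi z - q / 2 * normal_pdf1 z|
    <= 2 * K * q ^+ 2.
Proof.
move=> /andP[q0 q1] phiK; set v := Num.sqrt (1 + q).
have v1 : 1 <= v by rewrite -[leLHS]sqrtr1 ler_wsqrtr// lerDl.
have v2 : v ^+ 2 = 1 + q by rewrite sqr_sqrtr//; lra.
have vq : v - 1 <= q / 2 by nra.
have v0 : v != 0 by rewrite gt_eqF//; lra.
(* The map [r |-> Phi (z * r)] is expanded at 1 with increment [h], which lies between [- q / 2] and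
   0. *)
pose h := v^-1 - 1.
have hE : - h = (v - 1) / v by rewrite /h; field.
have h0 : 0 <= - h by rewrite hE divr_ge0//; lra.
have hq : - h <= q / 2.
  by rewrite hE; apply: le_trans vq; rewrite ler_pdivrMr; nra.
have hn : `|h| = - h by rewrite ler0_norm//; lra.
have T : `|Phi (z * (1 + h)) - Phi (z * 1) - h * (z * phi (z * 1))|
    <= (4 * K) * h ^+ 2.
  apply: (@taylor2 _ (fun r => Phi (z * r)) (fun r => z * phi (z * r))
            (fun r => z ^+ 2 * normal_pdf1 (z * r))) => y yh.
  - have -> : (fun r => Phi (z * r)) = Phi \o (fun r => z * r) by [].
    by apply: is_derive_eq; rewrite /GRing.scale/=; ring.
  - have -> : (fun r => z * phi (z * r)) =
      (fun r => z * (phi \o (fun r => z * r)) r) by [].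
    by apply: is_derive_eq; rewrite /GRing.scale/=; ring.
  (* Since [|h| <= 1/2], [y] stays above [1/2]; the factor [1 / y^2 <= 4] explains the constant
     [4 * K]. *)
  - have y2 : 1 / 2 <= y by move: yh; rewrite hn ler_norml; lra.
    have -> : z ^+ 2 * normal_pdf1 (z * y) =
        - ((z * y) ^+ 3 * phi (z * y)) / y ^+ 2.
      by rewrite /normal_pdf1; field; lra.
    have y4 : (y ^+ 2)^-1 <= 4.
      rewrite -[leRHS]invrK lef_pV2 ?posrE; nra.
    rewrite normrM normrN mulrC normfV ger0_norm ?sqr_ge0//.
    by rewrite ler_pM ?invr_ge0 ?sqr_ge0// phiK.
(* Replacing [h] by [- q / 2] in the linear term costs only order [q^2]. *)
have hz : `|(h + q / 2) * (z ^+ 1 * phi z)| <= 3 / 8 * q ^+ 2 * K.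
  rewrite normrM ler_pM// ?phiK//.
  have -> : h + q / 2 = (v - 1) ^+ 2 * (v + 2) / (2 * v).
    have -> : q = v ^+ 2 - 1 by rewrite v2; ring.
    by rewrite /h; field.
  have v' : 0 <= (v + 2) / (2 * v) <= 3 / 2.
    rewrite divr_ge0/=; [|lra..].
    rewrite ler_pdivrMr; lra.
  rewrite -mulrA normrM !ger0_norm ?sqr_ge0 ?(andP v').1//.
  apply: (@le_trans _ _ ((q / 2) ^+ 2 * (3 / 2))).
    rewrite ler_pM ?sqr_ge0 ?(andP v').1 ?(andP v').2// lerXn2r ?nnegrE//; lra.
  lra.
have -> : z / v = z * (1 + h) by rewrite /h; field.
have -> : Phi (z * (1 + h)) - Phi z - q / 2 * normal_pdf1 z =
   (Phi (z * (1 + h)) - Phi (z * 1) - h * (z * phi (z * 1))) +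
   (h + q / 2) * (z ^+ 1 * phi z).
  by rewrite /normal_pdf1 !mulr1; ring.
have K0 : 0 <= K by apply: le_trans (phiK 0 0 isT); exact: normr_ge0.
apply: (le_trans (ler_normD _ _)); apply: (le_trans (lerD T hz)).
have : h ^+ 2 <= (q / 2) ^+ 2.
  by rewrite -sqrrN lerXn2r ?nnegrE//; lra.
move=> hh.
have : K * h ^+ 2 <= K * (q / 2) ^+ 2 by rewrite ler_wpM2l.
have := mulr_ge0 K0 (sqr_ge0 q); lra.
Qed.

Variable b : nat.
Hypothesis b_ge2 : (2 <= b)%N.

Definition digit_avg (g : nat -> R) : R := b%:R^-1 * \sum_(d < b) g d.
Definition digit_mean : R := (b%:R - 1) / 2.
Definition digit_var : R := (b%:R ^+ 2 - 1) / 12.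

Let bR_ge2 : 2 <= b%:R :> R. Proof. by rewrite ler_nat. Qed.
Let bR_gt0 : 0 < b%:R :> R. Proof. exact: lt_le_trans bR_ge2. Qed.
Let bR_neq0 : b%:R != 0 :> R. Proof. by rewrite gt_eqF. Qed.

Lemma digit_var_gt0 : 0 < digit_var.
Proof. by rewrite /digit_var; have := bR_ge2; nra. Qed.

(** The two power sums are paired by [*] so that [rewrite] picks whichever applies. *)
Lemma sum_ordX (n : nat) :
  (\sum_(d < n) d%:R = n%:R * (n%:R - 1) / 2 :> R) *
  (\sum_(d < n) d%:R ^+ 2 = n%:R * (n%:R - 1) * (2 * n%:R - 1) / 6 :> R).
Proof.
elim: n => [|n [IH1 IH2]]; first by rewrite !big_ord0 !mul0r.
by rewrite !big_ord_recr/= IH1 IH2 -natr1; split; field.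
Qed.

Lemma digit_avgD g1 g2 :
  digit_avg (fun d => g1 d + g2 d) = digit_avg g1 + digit_avg g2.
Proof. by rewrite /digit_avg big_split mulrDr. Qed.

Lemma digit_avgZ a g : digit_avg (fun d => a * g d) = a * digit_avg g.
Proof. by rewrite /digit_avg -mulr_sumr mulrCA. Qed.

Lemma digit_avg_cst a : digit_avg (fun=> a) = a.
Proof. by rewrite /digit_avg sumr_const card_ord -[a *+ _]mulr_natl mulKf. Qed.

Lemma ler_digit_avg g1 g2 :
  (forall d, (d < b)%N -> g1 d <= g2 d) -> digit_avg g1 <= digit_avg g2.
Proof.
move=> g12; rewrite /digit_avg ler_wpM2l ?invr_ge0// ler_sum// => d _.
exact: g12.
Qed.

Lemma ler_norm_digit_avg g M :
  (forall d, (d < b)%N -> `|g d| <= M) -> `|digit_avg g| <= M.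
Proof.
move=> gM; rewrite /digit_avg normrM normfV normr_nat.
rewrite ler_pdivrMl//.
apply: (le_trans (ler_norm_sum _ _ _)).
apply: (@le_trans _ _ (\sum_(d < b) M)); first by apply: ler_sum => d _; exact: gM.
by rewrite sumr_const card_ord mulr_natl.
Qed.

Lemma digit_avg_id : digit_avg (fun d => d%:R) = digit_mean.
Proof. by rewrite /digit_avg sum_ordX /digit_mean; field; exact: bR_neq0. Qed.

Lemma digit_avg_centered : digit_avg (fun d => d%:R - digit_mean) = 0.
Proof. by rewrite digit_avgD digit_avg_id digit_avg_cst subrr. Qed.

Lemma digit_avg_sqr : digit_avg (fun d => (d%:R - digit_mean) ^+ 2) = digit_var.
Proof.
rewrite (_ : (fun d => _) = (fun d => d%:R ^+ 2 +
   (- 2 * digit_mean) * d%:R + digit_mean ^+ 2)); last first.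
  by apply/funext => d; ring.
rewrite !digit_avgD digit_avgZ digit_avg_id digit_avg_cst.
by rewrite /digit_avg sum_ordX /digit_mean /digit_var; field; exact: bR_neq0.
Qed.

(** Both terms are compared with the same second order expansion around [z = (c - x) / sqrt t]. In
    space, the linear term vanishes as the digit is centered, and the quadratic one averages to
    [digit_var], matching the time derivative. The remainders are of order [t^-3/2] in space and
    [t^-2] in time, the latter being smaller since [t >= 1]. *)
Lemma normal_cdf_digit_step : exists2 K : R, 0 < K &
  forall t c x : R, 1 <= t -> digit_var <= t ->
  `|digit_avg (fun d => Phi ((c - (x + (d%:R - digit_mean))) / Num.sqrt t))
    - Phi ((c - x) / Num.sqrt (t + digit_var))| <= K / (t * Num.sqrt t).
Proof.
have [K K0 phiK] := normal_pdf_poly_bound R.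
have K'0 : 0 < 2 * K by lra.
exists (2 * K * (b%:R ^+ 3 + digit_var ^+ 2)).
  by rewrite mulr_gt0// ltr_wpDr ?sqr_ge0// exprn_gt0.
move=> t c x t1 st.
have t0 : 0 < t by lra.
set w : R := Num.sqrt t.
have w1 : 1 <= w by rewrite -[leLHS]sqrtr1 ler_wsqrtr.
have w2 : w ^+ 2 = t by rewrite sqr_sqrtr//; lra.
have w0 : w != 0 by rewrite gt_eqF//; lra.
(* [k d] is the displacement by the digit [d] and [q] the time increment, both rescaled to time
   1. *)
pose z := (c - x) / w; pose k d : R := - ((d%:R - digit_mean) / w).
pose q := digit_var / t.
have s0 := digit_var_gt0.
have q01 : 0 <= q <= 1.
  by rewrite divr_ge0 ?(ltW s0) ?(ltW t0)//= ler_pdivrMr// mul1r.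
have -> : (c - x) / Num.sqrt (t + digit_var) = z / Num.sqrt (1 + q).
  rewrite /z -mulrA -invfM -sqrtrM; last lra.
  by rewrite /q; congr (_ / Num.sqrt _); field; lra.
have phi2K y : `|normal_pdf2 y| <= 2 * K.
  rewrite /normal_pdf2 mulrBl mul1r (le_trans (ler_normB _ _))//.
  have := phiK y 2%N isT; have := phiK y 0%N isT; rewrite expr0 mul1r; lra.
have T d : (d < b)%N -> `|Phi (z + k d) - Phi z - k d * phi z
    - k d ^+ 2 / 2 * normal_pdf1 z| <= 2 * K * (b%:R ^+ 3 / (t * w)).
  move=> db; apply: (@le_trans _ _ (2 * K * `|k d| ^+ 3)).
    exact: (@taylor3 _ _ _ _ (@normal_pdf2 R)).
  rewrite ler_pM2l// /k normrN normrM normfV (ger0_norm (x := w)); last lra.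
  rewrite expr_div_n -w2 -exprSr ler_pM2r ?invr_gt0 ?exprn_gt0//; last lra.
  have dR : d%:R <= b%:R :> R by rewrite ler_nat ltnW.
  have d0 : 0 <= d%:R :> R by [].
  rewrite lerXn2r ?nnegrE// ler_norml /digit_mean.
  by move: bR_ge2 dR d0; set y := _%:R; set y2 := b%:R; lra.
have kE : digit_avg (fun d => Phi (z + k d)) - Phi z - q / 2 * normal_pdf1 z
    = digit_avg (fun d => Phi (z + k d) - Phi z - k d * phi z
        - k d ^+ 2 / 2 * normal_pdf1 z).
  rewrite (_ : (fun d => _ - _ - _ - _) = (fun d => Phi (z + k d) + - Phi z
      + (phi z / w) * (d%:R - digit_mean)
      + (- normal_pdf1 z / (2 * t)) * (d%:R - digit_mean) ^+ 2)); last first.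
    by apply/funext => d; rewrite /k -w2; field.
  rewrite !digit_avgD digit_avg_cst !digit_avgZ digit_avg_sqr digit_avg_centered.
  by rewrite /q; field; lra.
rewrite (_ : (fun d => _) = (fun d => Phi (z + k d))); last first.
  by apply/funext => d; congr Phi; rewrite /z /k; field.
rewrite (_ : _ - _ = (digit_avg (fun d => Phi (z + k d)) - Phi z
    - q / 2 * normal_pdf1 z) - (Phi (z / Num.sqrt (1 + q)) - Phi z
    - q / 2 * normal_pdf1 z)); last by ring.
apply: (le_trans (ler_normB _ _)); rewrite kE.
apply: (le_trans (lerD (ler_norm_digit_avg T) (normal_cdf_rescale z q01 phiK))).
rewrite -[leRHS]mulrA [X in _ <= _ * X]mulrDl [leRHS]mulrDr lerD2l ler_pM2l// /q.
rewrite expr_div_n ler_pM2l ?exprn_gt0// lef_pV2 ?posrE ?exprn_gt0 ?mulr_gt0//; last lra.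
by rewrite expr2 ler_pM2l// -w2; nra.
Qed.

(** The transition operator of the random walk with centered uniform digits as increments. *)
Definition digit_step (f : R -> R) (x : R) : R :=
  digit_avg (fun d => f (x + (d%:R - digit_mean))).

(** Errors add up along the induction: [digit_step] is an average, so it does not amplify earlier
    errors, and each new one, committed at a time [t' >= t], is at most the one at time [t]. *)
Lemma normal_cdf_digit_walk : exists2 K : R, 0 < K &
  forall m (t c x : R), 1 <= t -> digit_var <= t ->
  `|iter m digit_step (fun y => Phi ((c - y) / Num.sqrt t)) x
    - Phi ((c - x) / Num.sqrt (t + m%:R * digit_var))|
    <= m%:R * (K / (t * Num.sqrt t)).
Proof.
have [K K0 HK] := normal_cdf_digit_step; exists K => // m t c + t1 st.
have s0 := digit_var_gt0.
elim: m => [|m IH] x /=; first by rewrite mul0r addr0 subrr normr0 mul0r.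
set t' := t + m%:R * digit_var.
have mm : 0 <= m%:R * digit_var by rewrite mulr_ge0// ltW.
have tt' : t <= t' by rewrite /t'; lra.
have -> : t + m.+1%:R * digit_var = t' + digit_var.
  by rewrite /t' -natr1; ring.
rewrite -(subrKA (digit_avg (fun d =>
  Phi ((c - (x + (d%:R - digit_mean))) / Num.sqrt t')))).
rewrite -[X in _ <= X * _]natr1 [leRHS]mulrDl [X in _ <= _ + X]mul1r.
apply: (le_trans (ler_normD _ _)); apply: lerD.
  rewrite /digit_step -[- digit_avg _]mulN1r -digit_avgZ -digit_avgD.
  by apply: ler_norm_digit_avg => d db; rewrite mulN1r IH.
have t'1 : 1 <= t' by lra.
apply: (le_trans (HK t' c x t'1 (le_trans st tt'))).
have sq : Num.sqrt t <= Num.sqrt t' by rewrite ler_wsqrtr.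
have sq0 : 0 < Num.sqrt t by rewrite sqrtr_gt0; lra.
by rewrite ler_pM2l// lef_pV2 ?posrE ?mulr_gt0 ?ler_pM//; lra.
Qed.

End heat.

(** * Averages over uniform words: moments of descents and the associated walk *)

Section words.
Variable R : realType.
Variable b : nat.
Hypothesis b_ge2 : (2 <= b)%N.
Implicit Types (g : seq nat -> R) (s : seq nat).

Local Notation avg := (@digit_avg R b).
Local Notation mean := (digit_mean R b).
Local Notation var := (digit_var R b).

Let b_gt0 : (0 < b)%N. Proof. exact: ltnW. Qed.
Let bR_neq0 : b%:R != 0 :> R. Proof. by rewrite gt_eqF// ltr0n. Qed.

(** Expectation over [n] uniform letters, defined by recursion so that conditioning on the first
    letter holds by computation; [word_avgE] gives the usual finite sum. *)
Fixpoint word_avg n g : R :=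
  if n is m.+1 then avg (fun d => word_avg m (fun s => g (d :: s)))
  else g [::].

Lemma word_avgS n g :
  word_avg n.+1 g = avg (fun d => word_avg n (fun s => g (d :: s))).
Proof. by []. Qed.

Lemma eq_digit_avg (f1 f2 : nat -> R) :
  (forall d, (d < b)%N -> f1 d = f2 d) -> avg f1 = avg f2.
Proof.
by move=> f12; rewrite /digit_avg; congr (_ * _); apply: eq_bigr => d _; exact: f12.
Qed.

Lemma eq_word_avg n g1 g2 :
  (forall s, size s = n -> all (fun d => d < b)%N s -> g1 s = g2 s) ->
  word_avg n g1 = word_avg n g2.
Proof.
elim: n g1 g2 => [|n IH] g1 g2 g12 /=; first exact: g12.
apply: eq_digit_avg => d db; apply: IH => s sn sb.
by apply: g12; rewrite /= ?sn// db.
Qed.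

Lemma ler_word_avg n g1 g2 :
  (forall s, size s = n -> all (fun d => d < b)%N s -> g1 s <= g2 s) ->
  word_avg n g1 <= word_avg n g2.
Proof.
elim: n g1 g2 => [|n IH] g1 g2 g12 /=; first exact: g12.
apply: ler_digit_avg => d db; apply: IH => s sn sb.
by apply: g12; rewrite /= ?sn// db.
Qed.

Lemma word_avgD n g1 g2 :
  word_avg n (fun s => g1 s + g2 s) = word_avg n g1 + word_avg n g2.
Proof.
elim: n g1 g2 => [//|n IH] g1 g2 /=; rewrite -digit_avgD.
by apply: eq_digit_avg => d _; rewrite IH.
Qed.

Lemma word_avgZ n a g : word_avg n (fun s => a * g s) = a * word_avg n g.
Proof.
elim: n g => [//|n IH] g /=; rewrite -digit_avgZ.
by apply: eq_digit_avg => d _; rewrite IH.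
Qed.

Lemma word_avg_cst n a : word_avg n (fun=> a) = a.
Proof.
elim: n => [//|n IH] /=; rewrite -[RHS](digit_avg_cst b_ge2).
by apply: eq_digit_avg => d _; exact: IH.
Qed.

Lemma word_avgE n g :
  word_avg n g = b%:R ^- n * \sum_(v : n.-tuple 'I_b) g (map val v).
Proof.
elim: n g => [|n IH] g.
  rewrite expr0 invr1 mul1r (big_pred1 [tuple]) /=//.
  by move=> v; apply/esym/eqP/val_inj/nilP; rewrite /nilp size_tuple.
rewrite /= /digit_avg.
under [X in _ * X = _]eq_bigr do rewrite IH.
rewrite -mulr_sumr mulrA -invfM exprS; congr (_ * _).
rewrite pair_big/= (reindex (fun v : n.+1.-tuple 'I_b => (thead v, behead_tuple v))) /=.
  by apply: eq_bigr => v _; congr g; rewrite [in RHS](tuple_eta v).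
exists (fun p => cons_tuple p.1 p.2) => [v _|[d v] _] /=.
  by apply: val_inj; rewrite /= [in RHS](tuple_eta v).
by congr (_, _); apply: val_inj.
Qed.

Lemma word_avg_prod n (h : nat -> nat -> R) :
  word_avg n (fun s => \prod_(j < n) h j (nth 0 s j)%N) = \prod_(j < n) avg (h j).
Proof.
elim: n h => [|n IH] h /=; first by rewrite !big_ord0.
rewrite big_ord_recl -(IH (fun j => h j.+1)) mulrC -digit_avgZ.
apply: eq_digit_avg => d _; rewrite mulrC -word_avgZ.
by apply: eq_word_avg => s _ _; rewrite big_ord_recl.
Qed.

(** Translation by [r] permutes the residues mod [b]. *)
Lemma digit_avg_shift r (f : nat -> R) :
  avg (fun d => f ((r + d) %% b)%N) = avg f.
Proof.
rewrite /digit_avg; congr (_ * _).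
pose sh (d : 'I_b) : 'I_b := Ordinal (ltn_pmod (r + d) b_gt0).
have sh_inj : injective sh.
  move=> d e /(congr1 val) /= /eqP; rewrite eqn_modDl => /eqP.
  by rewrite !modn_small// => /val_inj.
by rewrite [RHS](reindex_inj sh_inj).
Qed.

Definition letter_sums r s : seq nat := scanl (fun q d => (q + d) %% b)%N r s.

(** Running remainders of a uniform word are again uniform: from any remainder, exactly one digit
    leads to the prescribed next one. *)
Lemma word_avg_letter_sums r s : all (fun d => d < b)%N s ->
  word_avg (size s) (fun u => (letter_sums r u == s)%:R) = b%:R ^- size s.
Proof.
elim: s r => [|k s IH] r /=; first by rewrite expr0 invr1.
move=> /andP[kb sb].
transitivity (avg (fun d => (((r + d) %% b == k)%N)%:R * b%:R ^- size s)).
  apply: eq_digit_avg => d _; rewrite -(IH k sb) -word_avgZ.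
  apply: eq_word_avg => u _ _; rewrite eqseq_cons.
  by case: eqP => [->|_]; rewrite ?mul1r ?mul0r.
rewrite (digit_avg_shift r (fun d => (d == k)%:R * b%:R ^- size s)).
rewrite /digit_avg (bigD1 (Ordinal kb))//= eqxx mul1r big1 ?addr0; last first.
  move=> d /negPf dk; have -> : (d == k :> nat) = false by rewrite -dk.
  by rewrite mul0r.
by rewrite exprS invfM.
Qed.

(** The letter [a] stands before the word, which allows induction on [s] given the preceding
    letter. *)
Fixpoint descents_from a s : nat :=
  if s is c :: s' then (c < a) + descents_from c s' else 0.

Definition descents s : nat :=
  if s is a :: s' then descents_from a s' else 0.

Lemma digit_avg_lt a (h : nat -> R) : (a <= b)%N ->
  avg (fun d => (d < a)%:R * h d) = b%:R^-1 * \sum_(d < a) h d.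
Proof.
move=> ab; rewrite /digit_avg; congr (_ * _).
rewrite (big_ord_widen b (fun d => h d))//.
rewrite [RHS]big_mkcond; apply: eq_bigr => d _.
by case: ifP => _; rewrite ?mul1r ?mul0r.
Qed.

(** Only the first comparison feels [a]: its probability is [a / b], against [mean / b] for a
    comparison of two uniform letters. The correction [(a - mean) / b] cancels once [a] is averaged
    too. *)
Lemma word_avg_descents_from n a : (a < b)%N ->
  word_avg n.+1 (fun s => (descents_from a s)%:R)
    = n.+1%:R * (mean / b%:R) + (a%:R - mean) / b%:R.
Proof.
have lt_avg c : (c < b)%N -> avg (fun d => (d < c)%:R) = c%:R / b%:R.
  move=> cb; transitivity (avg (fun d => (d < c)%:R * 1)).
    by apply: eq_digit_avg => d _; rewrite mulr1.
  by rewrite digit_avg_lt ?(ltnW cb)// sumr_const card_ord mulrC.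
elim: n a => [|n IH] a ab.
  rewrite /= (eq_digit_avg (f2 := fun d => (d < a)%:R)); last first.
    by move=> d _; rewrite addn0.
  by rewrite lt_avg//; field; exact: bR_neq0.
transitivity (avg (fun d => (d < a)%:R + n.+1%:R * (mean / b%:R) +
    b%:R^-1 * (d%:R - mean))).
  rewrite word_avgS; apply: eq_digit_avg => d db; rewrite -addrA [b%:R^-1 * _]mulrC -(IH d db).
  rewrite -[X in _ = X + _](word_avg_cst n.+1) -word_avgD.
  by apply: eq_word_avg => s _ _; rewrite /= natrD.
rewrite !digit_avgD digit_avg_cst// digit_avgZ digit_avg_centered// lt_avg//.
by rewrite -[in RHS]natr1; field; exact: bR_neq0.
Qed.

Lemma word_avg_descents n :
  word_avg n.+2 (fun s => (descents s)%:R) = n.+1%:R * (mean / b%:R).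
Proof.
transitivity (avg (fun a => n.+1%:R * (mean / b%:R) + b%:R^-1 * (a%:R - mean))).
  rewrite word_avgS; apply: eq_digit_avg => a ab; rewrite [b%:R^-1 * _]mulrC.
  exact: word_avg_descents_from.
by rewrite digit_avgD digit_avg_cst// digit_avgZ digit_avg_centered// mulr0 addr0.
Qed.

(** One step of the variance recursion. Given the next letter [c], the later descents have mean
    deviation [(c - mean) / b]; expanding the square around it, the first comparison and its cross
    term contribute exactly [((a - mean) / b)^2]. *)
Lemma word_avg_sqr_descents_from n a : (a < b)%N ->
  word_avg n.+2 (fun s => ((descents_from a s)%:R - n.+2%:R * (mean / b%:R)) ^+ 2)
  = ((a%:R - mean) / b%:R) ^+ 2 +
    word_avg n.+2 (fun s => ((descents s)%:R - n.+1%:R * (mean / b%:R)) ^+ 2).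
Proof.
move=> ab; set m := mean / b%:R.
pose Z c s : R := (descents_from c s)%:R - n.+1%:R * m.
pose Q c := word_avg n.+1 (fun s => Z c s ^+ 2).
(* As the indicator [(c < a)] equals its square, all terms but [Q c] reduce to an indicator times an
   affine function of [c], plus an affine function. *)
transitivity (avg (fun c => (c < a)%:R * (1 - 2 * m - 2 * m + 2 / b%:R * c%:R) +
    m ^+ 2 + - (2 * m / b%:R) * (c%:R - mean) + Q c)).
  rewrite word_avgS; apply: eq_digit_avg => c cb.
  transitivity (word_avg n.+1 (fun s => ((c < a)%:R - m) ^+ 2 +
      2 * ((c < a)%:R - m) * Z c s + Z c s ^+ 2)).
    by apply: eq_word_avg => s _ _; rewrite /Z /= natrD -[n.+2%:R]natr1; ring.
  rewrite !word_avgD word_avg_cst word_avgZ -/(Q c).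
  have -> : word_avg n.+1 (Z c) = (c%:R - mean) / b%:R.
    by rewrite word_avgD word_avg_cst word_avg_descents_from// /m; ring.
  by rewrite /m; case: (c < a)%N => /=; field; exact: bR_neq0.
rewrite !digit_avgD digit_avg_cst// digit_avgZ digit_avg_centered//.
rewrite digit_avg_lt ?(ltnW ab)// big_split/= -mulr_sumr sumr_const card_ord.
rewrite sum_ordX mulr0 addr0; congr (_ + _).
by rewrite /m /digit_mean -[_ *+ a]mulr_natl; field; exact: bR_neq0.
Qed.

(** Each further letter adds the average of [((a - mean) / b)^2], that is [var / b^2]; a single
    comparison already has variance [3 * var / b^2], hence [n + 3]. *)
Lemma word_avg_sqr_descents n :
  word_avg n.+2 (fun s => ((descents s)%:R - n.+1%:R * (mean / b%:R)) ^+ 2)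
  = (n%:R + 3) * var / b%:R ^+ 2.
Proof.
elim: n => [|n IH].
  set m := mean / b%:R.
  transitivity (avg (fun a => b%:R^-1 * (1 - 2 * m) * a%:R + m ^+ 2)).
    rewrite word_avgS; apply: eq_digit_avg => a ab.
    transitivity (avg (fun c => (c < a)%:R * (1 - 2 * m) + m ^+ 2)).
      apply: eq_digit_avg => c cb; rewrite /= addn0 mul1r.
      by case: (c < a)%N => /=; ring.
    rewrite digit_avgD digit_avg_cst// digit_avg_lt ?(ltnW ab)//.
    by rewrite sumr_const card_ord -[_ *+ a]mulr_natl; ring.
  rewrite digit_avgD digit_avg_cst// digit_avgZ digit_avg_id//.
  by rewrite /m /digit_mean /digit_var; field; exact: bR_neq0.
transitivity (avg (fun a => b%:R ^- 2 * (a%:R - mean) ^+ 2 +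
    (n%:R + 3) * var / b%:R ^+ 2)).
  rewrite word_avgS; apply: eq_digit_avg => a ab; rewrite -IH.
  rewrite (word_avg_sqr_descents_from _ ab); congr (_ + _).
  by rewrite expr_div_n mulrC.
rewrite digit_avgD digit_avg_cst// digit_avgZ digit_avg_sqr//.
by rewrite -natr1; field; exact: bR_neq0.
Qed.

(* [b * descents + last letter] increases at each new letter [c] by [(c -
   previous letter) mod b], which is again a uniform digit. *)
Definition word_walk a s : R :=
  b%:R * (descents_from a s)%:R + (last a s)%:R - a%:R - (size s)%:R * mean.

(** The increment from letter [a] to letter [c] is the residue of [c - a], uniform for every [a];
    this is why the right-hand side does not mention [a]. *)
Lemma word_avg_walk n (f : R -> R) a x : (a < b)%N ->
  word_avg n (fun s => f (x + word_walk a s)) = iter n (digit_step b) f x.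
Proof.
elim: n a x => [|n IH] a x ab.
  by rewrite /= (_ : x + word_walk a [::] = x)// /word_walk /=; ring.
rewrite word_avgS iterS [RHS]/digit_step -[RHS](digit_avg_shift (b - a)).
apply: eq_digit_avg => c cb; rewrite -(IH c)//.
apply: eq_word_avg => s _ _; congr f.
(* The residue exceeds [c - a] by [b] precisely at a descent. *)
have -> : ((b - a + c) %% b)%:R = (c < a)%:R * b%:R + c%:R - a%:R :> R.
  case: ltnP => /= ca.
    rewrite modn_small; last by rewrite addnC addnBA ?(ltnW ab)// ltn_subLR; lia.
    by rewrite natrD natrB ?(ltnW ab)//; ring.
  have -> : (b - a + c = b + (c - a))%N by lia.
  rewrite modnDl modn_small; last by lia.
  by rewrite natrB//; ring.
by rewrite /word_walk /= natrD -[(size s).+1%:R]natr1; ring.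
Qed.

End words.

(** * From independent uniform digits to averages over words, and back *)

Section letters.
Variable R : realType.
Variable b : nat.
Hypothesis b_ge2 : (2 <= b)%N.
Context d (T : measurableType d) (P : probability T R).
Variable n : nat.
Implicit Types (B : nat -> {RV P >-> nat}) (s : seq nat).

Let b_gt0 : (0 < b)%N. Proof. exact: ltnW. Qed.

(** Digits are numbered from 1, positions in a word from 0. *)
Definition letters B (w : T) : seq nat := mkseq (fun i => B i.+1 w) n.

(** A finite form of [iid_uniform_digits], equivalent to it by [uniform_letters_iid] and
    [iid_uniform_letters]. *)
Definition uniform_letters B : Prop :=
  forall s, size s = n -> all (fun k => k < b)%N s ->
  P [set w | letters B w = s] = (b%:R ^- n)%:E.

Lemma letters_eq B s : size s = n ->
  [set w | letters B w = s]
    = \bigcap_(i in `I_n) (B i.+1 @^-1` [set nth 0%N s i]).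
Proof.
move=> sn; apply/seteqP; split=> [w /= <- i /= i_n|w /= Bs].
  by rewrite nth_mkseq.
apply: (@eq_from_nth _ 0%N) => [|i]; rewrite size_mkseq ?sn// => i_n.
by rewrite nth_mkseq//; exact: Bs.
Qed.

Lemma measurable_letters_eq B s : measurable [set w | letters B w = s].
Proof.
have [sn|sn] := eqVneq (size s) n; last first.
  rewrite (_ : [set _ | _] = set0); first exact: measurable0.
  apply/seteqP; split=> w //= ws; move: sn.
  by rewrite -ws size_mkseq eqxx.
rewrite letters_eq//; apply: fin_bigcap_measurable => // i _.
exact: measurable_funPTI.
Qed.

(** There are countably many words, so any set of words is a countable union of the events above. *)
Lemma measurable_letters B (Q : set (seq nat)) :
  measurable [set w | Q (letters B w)].
Proof.
rewrite (_ : [set _ | _] = \bigcup_s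
    if `[< Q s >] then [set w | letters B w = s] else set0); last first.
  apply/seteqP; split=> [w /= Qw|w [s _]].
    by exists (letters B w) => //; rewrite asboolT.
  by case: asboolP => //= Qs ->.
apply: countable_bigcupT_measurable => // s.
by case: asboolP => // _; exact: measurable_letters_eq.
Qed.

Lemma measurable_fun_letters B (g : seq nat -> R) :
  measurable_fun setT (g \o letters B).
Proof.
by move=> _ Y mY; rewrite setTI; exact: (measurable_letters B (g @^-1` Y)).
Qed.

Section uniform.
Variable B : nat -> {RV P >-> nat}.
Hypothesis uB : uniform_letters B.

Let E (v : n.-tuple 'I_b) := [set w | letters B w = map val v].

Let PE v : P (E v) = (b%:R ^- n)%:E.
Proof. by rewrite uB ?size_map ?size_tuple//; apply/allP => _ /mapP[k _ ->]; exact: ltn_ord. Qed.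

Let trivE : trivIset setT E.
Proof.
move=> u v _ _ [w []]; rewrite /E /= => -> /(inj_map val_inj) uv.
exact/val_inj.
Qed.

Let word_sum1 : \sum_(v : n.-tuple 'I_b) b%:R ^- n = 1 :> R.
Proof.
have := word_avgE b n (fun=> 1 : R).
rewrite word_avg_cst// mulr_sumr => e1; rewrite [RHS]e1; apply: eq_bigr => v _.
by rewrite mulr1.
Qed.

Let letters_tuple w : all (fun k => k < b)%N (letters B w) -> exists v, E v w.
Proof.
move=> ballw.
have sz : size (map (inord : nat -> 'I_b.-1.+1) (letters B w)) == n.
  by rewrite size_map size_mkseq.
have bE : b.-1.+1 = b by rewrite prednK.
exists (map_tuple (cast_ord bE) (Tuple sz)); rewrite /E /=.
elim: (letters B w) ballw => //= k u IH /andP[kb /IH <-].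
by rewrite inordK// bE.
Qed.

(** [uniform_letters] prescribes the mass of words over the alphabet only; these are [b^n] disjoint
    events of mass [b^-n], which exhaust the probability. *)
Lemma ae_letters : {ae P, forall w, all (fun k => k < b)%N (letters B w)}.
Proof.
have mU := measurable_letters B (fun s => all (fun k => k < b)%N s).
suff : P [set w | all (fun k => k < b)%N (letters B w)] = 1%E.
  move=> P1; exists (~` [set w | all (fun k => k < b)%N (letters B w)]); split.
  - exact: measurableC.
  - by rewrite probability_setC// P1 subee.
  - by [].
have -> : [set w | all (fun k => k < b)%N (letters B w)] = \bigcup_v E v.
  apply/seteqP; split=> [w /= ballw|w [v _ /= ->]]; last first.
    by apply/allP => _ /mapP[k _ ->]; exact: ltn_ord.
  by have [v vw] := letters_tuple ballw; exists v.
rewrite measure_fin_bigcup//=; last first.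
  by move=> v _; exact: measurable_letters_eq.
rewrite (eq_fsbigr (fun=> (b%:R ^- n)%:E)); last by move=> v _; exact: PE.
rewrite (fsbigE (index_enum (n.-tuple 'I_b))) ?index_enum_uniq//; last first.
  by move=> v _; rewrite mem_index_enum.
rewrite (eq_bigl xpredT) => [|v]; last by rewrite in_setT.
by rewrite sumEFin word_sum1.
Qed.

(** Almost everywhere, [g \o letters B] is a finite combination of the indicators of the events
    [E v]. *)
Lemma expectation_letters (g : seq nat -> R) :
  'E_P[g \o letters B]%E = (word_avg b n g)%:E.
Proof.
rewrite unlock.
pose h w := (\sum_(v : n.-tuple 'I_b) (g (map val v))%:E * (\1_(E v) w)%:E)%E.
have mE v : measurable (E v) by exact: measurable_letters_eq.
have int1 v : P.-integrable setT (fun w => (\1_(E v) w)%:E : \bar R).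
  exact: integrable_indic.
have int (v : n.-tuple 'I_b) : P.-integrable setT (fun w => (g (map val v))%:E * (\1_(E v) w)%:E)%E.
  exact: integrableZl.
rewrite (@ae_eq_integral _ _ _ P setT h)//; last 3 first.
- exact/measurable_EFinP/measurable_fun_letters.
- by apply: (measurable_int P); exact: integrable_sum.
- apply: filterS ae_letters => w ballw _ /=.
  have [v vw] : exists v, E v w by exact: letters_tuple.
  rewrite /h (bigD1 v)//= big1 ?adde0; last first.
    move=> u uv; rewrite indicE memNset ?mule0// => uw.
    by move/negP: uv; apply; apply/eqP; apply: trivE => //; exists w.
  by rewrite indicE mem_set//= mule1 vw.
rewrite /h integral_sum//.
rewrite word_avgE mulr_sumr -sumEFin; apply: eq_bigr => v _.
rewrite integralZl// integral_indic// setIT [in RHS]mulrC EFinM; congr (_ * _)%E.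
exact: PE.
Qed.

Lemma probability_letters (Q : set (seq nat)) :
  P [set w | Q (letters B w)] = (word_avg b n (fun s => \1_Q s))%:E.
Proof.
rewrite -expectation_letters -expectation_indic; last exact: measurable_letters.
by congr expectation; apply/funext => w /=; rewrite !indicE.
Qed.

Lemma letters_cylinder (S : {fset nat}) (F : nat -> set nat) :
  [set` S] `<=` [set i | (1 <= i <= n)%N] ->
  P (\bigcap_(i in [set` S]) B i @^-1` F i)
    = (\prod_(j < n) if j.+1 \in S then digit_avg b (\1_(F j.+1)) else 1 : R)%:E.
Proof.
move=> S_n.
(* An unconstrained position contributes the factor 1, so the indicator of [Q] is a product over all
   positions and [word_avg_prod] applies. *)
pose h (j k : nat) : R := if j.+1 \in S then \1_(F j.+1) k else 1.
pose Q := [set s | forall i, i \in S -> F i (nth 0%N s i.-1)].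
have -> : \bigcap_(i in [set` S]) B i @^-1` F i = [set w | Q (letters B w)].
  apply/seteqP; split=> w Bw i /= iS.
    have /andP[i1 i_n] := S_n _ iS.
    by rewrite nth_mkseq prednK//; exact: Bw.
  have /andP[i1 i_n] := S_n _ iS.
  by have := Bw i iS; rewrite nth_mkseq prednK.
rewrite probability_letters; congr EFin.
transitivity (word_avg b n (fun s => \prod_(j < n) h j (nth 0%N s j))).
  apply: eq_word_avg => s sn _.
  rewrite indicE; have [sQ|sQ] := pselect (Q s).
    rewrite mem_set// big1// => j _; rewrite /h; case: ifP => // jS.
    by rewrite indicE mem_set//; exact: (sQ j.+1).
  rewrite memNset//; move: sQ => /existsNP[i /not_implyP[iS nF]].
  have /andP[i1 i_n] := S_n _ iS.
  have i'n : (i.-1 < n)%N by rewrite prednK.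
  rewrite (bigD1 (Ordinal i'n))//= {1}/h prednK// iS indicE memNset ?mul0r//.
rewrite word_avg_prod//; apply: eq_bigr => j _; rewrite /h.
by case: ifP => // _; rewrite digit_avg_cst.
Qed.

Lemma letters_marginal i (F : set nat) : (1 <= i <= n)%N ->
  P (B i @^-1` F) = (digit_avg b (\1_F) : R)%:E.
Proof.
move=> i_n; have := @letters_cylinder [fset i]%fset (fun=> F).
rewrite (_ : [set` _] = [set i]); last first.
  by apply/seteqP; split => j /=; rewrite inE => /eqP.
rewrite bigcap_set1 => ->; last by move=> _ ->.
have i'n : (i.-1 < n)%N by case/andP: i_n => i1; rewrite prednK.
rewrite (bigD1 (Ordinal i'n))//= prednK; last by case/andP: i_n.
rewrite inE eqxx big1 ?mulr1// => j /eqP ji.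
case: ifP => //; rewrite inE => /eqP ij; case: ji.
by apply/val_inj; rewrite /= -ij.
Qed.

Lemma uniform_letters_iid : iid_uniform_digits b n P B.
Proof.
split=> [i i_n k|S S_n F mF].
  rewrite /distribution/= /pushforward letters_marginal//; congr EFin.
  have [kb|kb] := ltnP k b.
    rewrite /digit_avg (bigD1 (Ordinal kb))//= indicE mem_set// big1 ?addr0 ?mulr1//.
    move=> j jk; rewrite indicE memNset//= => jk'; move: jk.
    by rewrite eqE /= jk' eqxx.
  rewrite /digit_avg big1 ?mulr0// => j _; rewrite indicE memNset//= => jk.
  by move: kb; rewrite -jk leqNgt ltn_ord.
rewrite letters_cylinder// (eq_big_seq (fun i => (digit_avg b (\1_(F i)) : R)%:E)).
  rewrite prodEFin; congr EFin.
  rewrite -(big_mkord predT (fun j => if j.+1 \in S then digit_avg b (\1_(F j.+1)) else 1)).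
  rewrite -(big_add1 _ _ 0 n.+1 predT (fun j => if j \in S then digit_avg b (\1_(F j)) else 1)).
  rewrite -big_mkcond -big_filter; apply: perm_big.
  apply: uniq_perm; rewrite ?filter_uniq ?iota_uniq ?fset_uniq// => i.
  rewrite mem_filter mem_index_iota andb_idr// => /S_n /=.
  by rewrite ltnS.
by move=> i /S_n; exact: letters_marginal.
Qed.

End uniform.

(** Independence is applied to all indices from 1 to [n], with the letters of [s] as singleton
    events. *)
Lemma iid_uniform_letters B : iid_uniform_digits b n P B -> uniform_letters B.
Proof.
move=> [uB iB] s sn sb; rewrite letters_eq//.
pose S : {fset nat} := [fset i in index_iota 1 n.+1]%fset.
have S_n : [set` S] `<=` [set i | (1 <= i <= n)%N].
  by move=> i /=; rewrite in_fset /= mem_index_iota ltnS.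
have := iB S S_n (fun i => [set nth 0%N s i.-1]) (fun=> I).
rewrite (_ : \bigcap_(i in _) _ = \bigcap_(i in `I_n) B i.+1 @^-1` [set nth 0%N s i]); last first.
  apply/seteqP; split=> w /= Bw i /= i_n.
    by apply: (Bw i.+1); rewrite /= in_fset /= mem_index_iota ltnS.
  move: i_n; rewrite in_fset /= mem_index_iota ltnS => /andP[i0 i_n].
  by have := Bw i.-1; rewrite /= prednK//; apply.
move=> ->; rewrite (eq_big_seq (fun=> (b%:R^-1 : R)%:E)).
  rewrite prodEFin; congr EFin.
  rewrite (perm_big (index_iota 1 n.+1)).
    by rewrite prodr_const_nat subn1 exprVn.
  apply: uniq_perm; rewrite ?iota_uniq ?fset_uniq// => i.
  by rewrite in_fset.
move=> i /S_n /= /andP[i1 i_n].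
have := uB i _ (nth 0%N s i.-1); rewrite i1 i_n /distribution /pushforward => -> //.
rewrite ifT//; apply: (allP sb); apply: mem_nth.
by rewrite sn prednK.
Qed.

End letters.

(** * Descents and carries of digit sequences, read on words *)

Lemma mkseqS (U : Type) (f : nat -> U) n :
  mkseq f n.+1 = f 0%N :: mkseq (fun i => f i.+1) n.
Proof. by rewrite /mkseq /= (iotaDl 1) -map_comp. Qed.

Lemma num_descentsE n (x : nat -> nat) :
  num_descents n x = descents (mkseq (fun i => x i.+1) n).
Proof.
rewrite /num_descents; case: n => [|n]; first by rewrite big_geq.
elim: n x => [|n IH] x; first by rewrite big_geq.
rewrite big_ltn// big_add1 [n.+2.-1]/= (IH (x \o S)).
by rewrite !mkseqS.
Qed.

Lemma remainder_letters b n (a : nat -> nat) :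
  mkseq (fun i => remainder b a i.+1) n
    = letter_sums b 0 (mkseq (fun i => a i.+1) n).
Proof.
rewrite /remainder.
(* The induction needs an arbitrary initial remainder [r] and an arbitrary offset [m]. *)
suff: forall m r, mkseq (fun i => (r + \sum_(m <= j < m + i.+1) a j) %% b)%N n
    = letter_sums b r (mkseq (fun i => a (m + i)%N) n).
  by move=> /(_ 1%N 0%N) <-; apply: eq_mkseq => i; rewrite add0n add1n.
elim: n => [//|n IH] m r; rewrite !mkseqS /= addn1 big_nat1 addn0; congr (_ :: _).
have -> : mkseq (fun i => a (m + i.+1)%N) n = mkseq (fun i => a (m.+1 + i)%N) n.
  by apply: eq_mkseq => i; rewrite addSnnS.
rewrite -/(letter_sums b _ _) -IH; apply: eq_mkseq => i.
rewrite modnDml big_ltn; last by lia.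
by rewrite addnA addSnnS.
Qed.

(** With remainder [r] and digit [a] both below [b], a carry gives the new remainder
    [r + a - b < r], and otherwise it is [r + a >= r]. *)
Lemma carries_descents b n (a : nat -> nat) : (0 < b)%N ->
  all (fun k => k < b)%N (mkseq (fun i => a i.+1) n) ->
  num_carries b n a = num_descents n (remainder b a).
Proof.
move=> b_gt0 ab; apply: eq_big_nat => i /andP[i1 i_n]; congr nat_of_bool.
have {}ab : (a i.+1 < b)%N.
  have /(_ (a i.+1)) := allP ab; apply.
  by apply/mapP; exists i => //; rewrite mem_iota.
rewrite /carry /descent.
have -> : remainder b a i.+1 = ((remainder b a i + a i.+1) %% b)%N.
  by rewrite /remainder big_nat_recr//= modnDml.
have rb : (remainder b a i < b)%N by exact: ltn_pmod.
move: (remainder b a i) rb => r rb.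
have [br|br] := leqP b (r + a i.+1).
  have -> : (r + a i.+1 = b + (r + a i.+1 - b))%N by lia.
  by rewrite modnDl modn_small; lia.
by rewrite modn_small//; lia.
Qed.

(** * Moments and distribution function of the number of descents *)

Section descents_rv.
Variables (R : realType) (b n : nat).
Hypothesis b_ge2 : (2 <= b)%N.
Context d (T : measurableType d) (P : probability T R).

Let bR_neq0 : b%:R != 0 :> R. Proof. by rewrite gt_eqF// ltr0n ltnW. Qed.

Lemma uniform_remainders (A : nat -> {RV P >-> nat}) :
  uniform_letters b n A ->
  uniform_letters b n (fun i => rv_remainder A b i : {RV P >-> nat}).
Proof.
move=> uA s sn sb.
transitivity (P [set w | [set u | letter_sums b 0 u = s] (letters n A w)]).
  congr (P _); apply/funext => w /=; rewrite /letters /=.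
  by rewrite (remainder_letters b n (fun j => A j w)).
rewrite (probability_letters b_ge2 uA); congr EFin.
rewrite -sn -(word_avg_letter_sums R b_ge2 0 sb); apply: eq_word_avg => u _ _.
rewrite indicE; congr (nat_of_bool _)%:R.
by apply/idP/eqP => [/set_mem|us]; [|exact/mem_set].
Qed.

Variable B : nat -> {RV P >-> nat}.
Hypothesis uB : uniform_letters b n B.
Hypothesis n_ge2 : (2 <= n)%N.

Lemma total_descentsE :
  total_descents B n = (fun s => (descents s)%:R : R) \o letters n B.
Proof. by apply/funext => w; rewrite /total_descents num_descentsE. Qed.

Lemma expectation_total_descents :
  'E_P[total_descents B n]%E = ((n%:R - 1) * (1 / 2 - 1 / (2 * b%:R)))%:E.
Proof.
rewrite total_descentsE (expectation_letters b_ge2 uB); congr EFin.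
case: n n_ge2 => [//|[//|m]] _.
rewrite word_avg_descents// /digit_mean -[m.+2%:R]natr1.
by field; exact: bR_neq0.
Qed.

Lemma variance_total_descents :
  'V_P[total_descents B n] = ((n%:R + 1) / 12 * (1 - 1 / b%:R ^+ 2))%:E.
Proof.
rewrite /variance unlock expectation_total_descents/=.
set e : R := _ * _.
rewrite (_ : (_ * _)%R = (fun s => ((descents s)%:R - e) ^+ 2) \o letters n B); last first.
  by rewrite total_descentsE; apply/funext => w /=; rewrite expr2.
rewrite (expectation_letters b_ge2 uB); congr EFin; rewrite /e.
case: n n_ge2 => [//|[//|m]] _.
have -> : (m.+2%:R - 1) * (1 / 2 - 1 / (2 * b%:R)) = m.+1%:R * (digit_mean R b / b%:R).
  by rewrite /digit_mean -[m.+2%:R]natr1; field; exact: bR_neq0.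
rewrite word_avg_sqr_descents// /digit_var -[m.+2%:R]natr1 -[m.+1%:R]natr1.
by field; exact: bR_neq0.
Qed.

(** Multiplying by [b] puts the event on the scale of [word_walk]: the variance of [b * T] is
    [(n + 1) * digit_var]. *)
Lemma cdf_standardized_descents (x : R) :
  cdf (standardized P (total_descents B n) : {RV P >-> R}) x = (word_avg b n
    \1_[set s | b%:R * (descents s)%:R - n.-1%:R * digit_mean R b
      <= x * Num.sqrt (n.+1%:R * digit_var R b)])%:E.
Proof.
set Q := [set s | _].
rewrite /cdf/= /distribution /pushforward.
rewrite (_ : _ @^-1` _ = [set w | Q (letters n B w)]); last first.
  apply/funext => w /=; rewrite in_itv /= /standardized /Q /=.
  rewrite expectation_total_descents variance_total_descents /=.
  have -> : (n%:R + 1) / 12 * (1 - 1 / b%:R ^+ 2) =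
      n.+1%:R * digit_var R b / b%:R ^+ 2 :> R.
    by rewrite /digit_var -natr1; field; exact: bR_neq0.
  have v0 : 0 < n.+1%:R * digit_var R b.
    by rewrite mulr_gt0// digit_var_gt0.
  have -> : Num.sqrt (n.+1%:R * digit_var R b / b%:R ^+ 2) =
      Num.sqrt (n.+1%:R * digit_var R b) / b%:R.
    by rewrite sqrtrM ?(ltW v0)// sqrtrV ?sqr_ge0// sqrtr_sqr normr_nat.
  have s0 : 0 < Num.sqrt (n.+1%:R * digit_var R b) / b%:R.
    by rewrite divr_gt0 ?sqrtr_gt0// ltr0n ltnW.
  rewrite ler_pdivrMr// total_descentsE /= mulrA ler_pdivlMr ?ltr0n 1?ltnW//.
  congr (is_true (_ <= _)).
  case: n n_ge2 => [//|m] _; rewrite /digit_mean -natr1 /=.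
  by field; exact: bR_neq0.
by rewrite (probability_letters b_ge2 uB).
Qed.

End descents_rv.

(** * Bounds on the distribution function by smoothed indicators *)

Section sandwich.
Variables (R : realType) (b : nat).
Hypothesis b_ge2 : (2 <= b)%N.
Local Notation Phi := (@normal_cdf R).
Local Notation var := (digit_var R b).

(** Here [m] counts comparisons, hence the [m.+1] letters. *)
Definition descents_cdf m (y : R) : R := word_avg b m.+1
  \1_[set s | b%:R * (descents s)%:R - m%:R * digit_mean R b <= y].

(** The indicator is replaced by [Phi ((c - walk) / sqrt t)], at the price of [Phi (- D / sqrt t)];
    the shift of [c] by [b] absorbs the gap between the walk and the centered [b * descents], and
    the shift by [D] the width of the smoothing. *)
Lemma descents_cdf_bounds : exists2 K : R, 0 < K &
  forall m (t y D : R), 1 <= t -> var <= t ->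
  Phi ((y - b%:R - D) / Num.sqrt (t + m%:R * var))
    - m%:R * (K / (t * Num.sqrt t)) - Phi (- (D / Num.sqrt t))
  <= descents_cdf m y <=
  Phi ((y + b%:R + D) / Num.sqrt (t + m%:R * var))
    + m%:R * (K / (t * Num.sqrt t)) + (1 - Phi (D / Num.sqrt t)).
Proof.
have [K K0 HK] := normal_cdf_digit_walk R b_ge2; exists K => // m t y D t1 st.
have t0 : 0 < Num.sqrt t by rewrite sqrtr_gt0; lra.
set err := m%:R * (K / _).
have walk c : `|word_avg b m.+1 (fun s =>
      Phi ((c - word_walk R b (head 0%N s) (behead s)) / Num.sqrt t))
    - Phi (c / Num.sqrt (t + m%:R * var))| <= err.
  rewrite word_avgS (eq_digit_avg (f2 := fun=> iter m (digit_step b)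
      (fun z => Phi ((c - z) / Num.sqrt t)) 0)) => [|a ab]; last first.
    rewrite -(word_avg_walk b_ge2 _ _ _ ab); apply: eq_word_avg => s _ _ /=.
    by rewrite add0r.
  by rewrite digit_avg_cst//; have := HK m t c 0 t1 st; rewrite subr0.
(* The difference is the last letter minus the first one. *)
have close s : size s = m.+1 -> all (fun k => k < b)%N s ->
    `|word_walk R b (head 0%N s) (behead s)
      - (b%:R * (descents s)%:R - m%:R * digit_mean R b)| <= b%:R.
  case: s => //= a s [sm] /andP[ab sb].
  have lb : (last a s < b)%N.
    by case: (lastP s) sb => [//|s' l]; rewrite all_rcons last_rcons => /andP[].
  rewrite /word_walk sm.
  rewrite (_ : _ - _ = (last a s)%:R - a%:R); last by ring.
  have : (last a s)%:R <= b%:R :> R by rewrite ler_nat ltnW.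
  have : a%:R <= b%:R :> R by rewrite ler_nat ltnW.
  have : 0 <= (last a s)%:R :> R by [].
  have : 0 <= a%:R :> R by [].
  by rewrite ler_norml; move: (_%:R) (a%:R) (b%:R) => u v z *; lra.
apply/andP; split.
(* Off the event, the walk exceeds [y - b], so the smoothed indicator is at most
   [Phi (- D / sqrt t)]; on it, 1 is a sufficient bound. *)
- have := walk (y - b%:R - D); rewrite ler_norml => /andP[W _].
  set lhs := Phi _; set z := Phi (- _).
  suff : word_avg b m.+1 (fun s =>
      Phi ((y - b%:R - D - word_walk R b (head 0%N s) (behead s)) / Num.sqrt t))
      <= descents_cdf m y + z by move: W; rewrite -/lhs; lra.
  rewrite -[z](word_avg_cst b_ge2 m.+1) -word_avgD; apply: ler_word_avg => s sm sb.
  have := close s sm sb; rewrite ler_norml indicE => /andP[c1 c2].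
  case: (boolP (s \in _)) => [_|/negP sQ] /=.
    by apply: (le_trans (normal_cdf_le1 _)); rewrite lerDl normal_cdf_ge0.
  rewrite add0r; apply: normal_cdf_homo.
  rewrite -mulNr ler_pM2r ?invr_gt0//.
  have : ~~ (b%:R * (descents s)%:R - m%:R * digit_mean R b <= y).
    by apply/negP => sy; apply: sQ; exact/mem_set.
  by rewrite -ltNge; lra.
- have := walk (y + b%:R + D); rewrite ler_norml => /andP[_ W].
  set rhs := Phi _; set z := Phi (D / _).
  suff : descents_cdf m y <= word_avg b m.+1 (fun s =>
      Phi ((y + b%:R + D - word_walk R b (head 0%N s) (behead s)) / Num.sqrt t))
      + (1 - z) by move: W; rewrite -/rhs; lra.
  rewrite -[1 - z](word_avg_cst b_ge2 m.+1) -word_avgD; apply: ler_word_avg => s sm sb.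
  have := close s sm sb; rewrite ler_norml indicE => /andP[c1 c2].
  case: (boolP (s \in _)) => [/set_mem/= sQ|_] /=; last first.
    by rewrite addr_ge0 ?normal_cdf_ge0// subr_ge0 normal_cdf_le1.
  suff : z <= Phi ((y + b%:R + D - word_walk R b (head 0%N s) (behead s)) / Num.sqrt t).
    by lra.
  apply: normal_cdf_homo; rewrite ler_pM2r ?invr_gt0//.
  by lra.
Qed.

End sandwich.

(** * Choice of the scales and passage to the limit *)

Section limit.
Variables (R : realType) (b : nat).
Hypothesis b_ge2 : (2 <= b)%N.
Local Notation Phi := (@normal_cdf R).
Local Notation var := (digit_var R b).

(** With [r] the 16th root of [n - 1], every scale is an integer power of [r]: [t / n] is about
    [r^-4], the accumulated error is [K * r^-2], the shift [r^7] is [r] times [sqrt t = r^6] but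
    negligible against the standard deviation, of order [r^8]. *)
Let root16 (z : R) : R := Num.sqrt (Num.sqrt (Num.sqrt (Num.sqrt z))).

Let root16X (z : R) : 0 <= z -> root16 z ^+ 16 = z.
Proof.
move=> z0; rewrite (exprM _ 2 8) sqr_sqrtr ?sqrtr_ge0//.
rewrite (exprM _ 2 4) sqr_sqrtr ?sqrtr_ge0//.
by rewrite (exprM _ 2 2) !sqr_sqrtr ?sqrtr_ge0.
Qed.

Let cvg_root16 : root16 (n.-1)%:R @[n --> \oo] --> +oo.
Proof.
apply/cvgryPge => A; have := nbhs_infty_ger (`|A| ^+ 16 + 1).
apply: filterS => -[|n].
  by rewrite leNgt ltr_wpDl.
rewrite -natr1 lerD2r => An /=.
rewrite (le_trans (ler_norm A))// -(@ler_pXn2r _ 16) ?nnegrE ?sqrtr_ge0//.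
by rewrite root16X.
Qed.

Let cvgX (u : R^nat) (l : R) k : u @ \oo --> l -> u n ^+ k @[n --> \oo] --> l ^+ k.
Proof. by move=> ul; exact: (cvg_comp u (fun z : R => z ^+ k) ul (@exprn_continuous R k l)). Qed.

Let cvg_sqrt (u : R^nat) (l : R) :
  u @ \oo --> l -> Num.sqrt (u n) @[n --> \oo] --> Num.sqrt l.
Proof. by move=> ul; exact: (cvg_comp u (@Num.sqrt R) ul (@sqrt_continuous R l)). Qed.

Let cvg_Phi (u : R^nat) (l : R) : u @ \oo --> l -> Phi (u n) @[n --> \oo] --> Phi l.
Proof.
move=> ul; apply: (cvg_comp u Phi ul).
exact/differentiable_continuous/derivable1_diffP.
Qed.

(** The argument of [Phi] in the bounds, with numerator and denominator divided by [r^8] and written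
    in [e = 1 / r]; [c] is the sign of the shift. It is continuous at [e = 0], with value [x]. *)
Let threshold (x c e : R) : R :=
  (x * Num.sqrt ((1 + 2 * e ^+ 16) * var) + c * (b%:R * e ^+ 8 + e))
    / Num.sqrt (e ^+ 4 + var).

Let cvg_threshold x c (u : R^nat) : u @ \oo --> (0 : R) ->
  threshold x c (u n) @[n --> \oo] --> x.
Proof.
move=> u0; have v0 := digit_var_gt0 R b_ge2.
have lim0 : threshold x c 0 = x.
  rewrite /threshold !expr0n /= !mulr0 !addr0 add0r mul1r mulr0 addr0 mulfK//.
  by rewrite gt_eqF// sqrtr_gt0.
rewrite -[X in _ --> X]lim0 /threshold; apply: cvgM; last apply: cvgV.
- apply: cvgD; apply: cvgM; [exact: cvg_cst| |exact: cvg_cst|].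
    apply: cvg_sqrt; apply: cvgM; last exact: cvg_cst.
    by apply: cvgD; [exact: cvg_cst|apply: cvgM; [exact: cvg_cst|exact: cvgX]].
  by apply: cvgD => //; apply: cvgM; [exact: cvg_cst|exact: cvgX].
- by rewrite expr0n add0r gt_eqF// sqrtr_gt0.
- by apply: cvg_sqrt; apply: cvgD; [exact: cvgX|exact: cvg_cst].
Qed.

Let thresholdE (x c r : R) m : 0 < r -> r ^+ 16 = m%:R ->
  (x * Num.sqrt (m.+2%:R * var) + c * (b%:R + r ^+ 7))
    / Num.sqrt (r ^+ 12 + m%:R * var) = threshold x c r^-1.
Proof.
move=> r0 rm; have v0 := digit_var_gt0 R b_ge2.
have r_neq0 : r != 0 by rewrite gt_eqF.
have sqrt_r8 z : 0 < z -> Num.sqrt (r ^+ 16 * z) = r ^+ 8 * Num.sqrt z.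
  move=> z0; rewrite sqrtrM ?exprn_ge0 ?(ltW r0)// (exprM r 8 2) sqrtr_sqr.
  by rewrite ger0_norm// exprn_ge0// ltW.
have -> : m.+2%:R * var = r ^+ 16 * ((1 + 2 * r^-1 ^+ 16) * var).
  by rewrite rm -[m.+2]addn2 natrD -rm; field.
have -> : r ^+ 12 + m%:R * var = r ^+ 16 * (r^-1 ^+ 4 + var).
  by rewrite -rm; field.
have e0 k : 0 < r^-1 ^+ k by rewrite exprn_gt0// invr_gt0.
have w0 : 0 < r^-1 ^+ 4 + var by rewrite addr_gt0.
rewrite !sqrt_r8//; last by rewrite mulr_gt0// addr_gt0// mulr_gt0.
rewrite /threshold; field.
by rewrite r_neq0 gt_eqF// sqrtr_gt0.
Qed.

Lemma cvg_descents_cdf (x : R) :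
  descents_cdf b n.-1 (x * Num.sqrt (n.+1%:R * var)) @[n --> \oo] --> Phi x.
Proof.
have [K K0 HK] := descents_cdf_bounds R b_ge2.
have v0 := digit_var_gt0 R b_ge2.
pose r n := root16 n.-1%:R.
pose e n := (r n)^-1.
have ry : r @ \oo --> +oo := cvg_root16.
have r1 : \forall n \near \oo, 1 <= r n.
  by move/cvgryPge : ry; apply.
have rv : \forall n \near \oo, var <= r n.
  by move/cvgryPge : ry; apply.
have e0 : e @ \oo --> (0 : R).
  by apply/gtr0_cvgV0 => //; apply: filterS r1 => n; exact: lt_le_trans.
apply: (@squeeze_cvgr _ _ _ _
  (fun n => Phi (threshold x (-1) (e n)) - K * e n ^+ 2 - Phi (- r n))
  (fun n => Phi (threshold x 1 (e n)) + K * e n ^+ 2 + (1 - Phi (r n)))).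
- near=> n.
  have rn1 : 1 <= r n by near: n.
  have rn0 : 0 < r n by exact: lt_le_trans rn1.
  have n2 : (1 < n)%N by near: n; exact: nbhs_infty_gt.
  have rn : r n ^+ 16 = n.-1%:R by rewrite root16X.
  have tv : var <= r n ^+ 12.
    rewrite (@le_trans _ _ (r n))//; first by near: n.
    by rewrite -[leLHS]expr1 ler_weXn2l.
  have := HK n.-1 (r n ^+ 12) (x * Num.sqrt (n.+1%:R * var)) (r n ^+ 7)
    (exprn_ege1 12 rn1) tv.
  have -> : Num.sqrt (r n ^+ 12) = r n ^+ 6.
    by rewrite (exprM _ 6 2) sqrtr_sqr ger0_norm// exprn_ge0// ltW.
  have -> : n.-1%:R * (K / (r n ^+ 12 * r n ^+ 6)) = K * e n ^+ 2.
    by rewrite -rn /e; field; rewrite gt_eqF.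
  have -> : r n ^+ 7 / r n ^+ 6 = r n by field; rewrite gt_eqF.
  have := thresholdE x 1 rn0 rn; have := thresholdE x (-1) rn0 rn.
  have -> : n.-1.+2 = n.+1 by rewrite prednK// ltnW.
  by rewrite !mulN1r !mul1r !opprD !addrA /e => <- <-.
- rewrite -[X in _ --> X]subr0 -[X in _ --> X - _]subr0.
  apply: cvgB; first apply: cvgB.
  + by apply: cvg_Phi; exact: cvg_threshold.
  + rewrite -(mulr0 K); apply: cvgM; first exact: cvg_cst.
    by have := @cvgX _ _ 2 e0; rewrite expr0n.
  + have rNy : - r n @[n --> \oo] --> -oo by exact/cvgNrNy.
    exact: (cvg_comp (fun n => - r n) Phi rNy (@cvg_normal_cdfNy R)).
- rewrite -[X in _ --> X]addr0 -[X in _ --> X + _]addr0.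
  apply: cvgD; first apply: cvgD.
  + by apply: cvg_Phi; exact: cvg_threshold.
  + rewrite -(mulr0 K); apply: cvgM; first exact: cvg_cst.
    by have := @cvgX _ _ 2 e0; rewrite expr0n.
  + rewrite -(subrr (1 : R)); apply: cvgB; first exact: cvg_cst.
    exact: (cvg_comp r Phi ry (@cvg_normal_cdfy R)).
Unshelve. all: by end_near. Qed.

End limit.

Theorem theorem2p1 (R : realType) (b : nat) (b_ge2 : (2 <= b)%N) :
  [/\ (forall (n : nat) (d : measure_display) (T : measurableType d)
         (P : probability T R) (A : nat -> {RV P >-> nat}),
         (2 <= n)%N -> iid_uniform_digits b n P A ->
         iid_uniform_digits b n P (fun i => rv_remainder A b i : {RV P >-> nat})
         /\ {ae P, forall w, num_carries b n (fun i => A i w)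
                      = num_descents n (fun i => rv_remainder A b i w)}),
      (forall (n : nat) (d : measure_display) (T : measurableType d)
         (P : probability T R) (B : nat -> {RV P >-> nat}),
         (2 <= n)%N -> iid_uniform_digits b n P B ->
         'E_P[total_descents B n]%E
           = ((n%:R - 1) * (1 / 2 - 1 / (2 * b%:R)))%:E
         /\ 'V_P[total_descents B n]
           = ((n%:R + 1) / 12 * (1 - 1 / b%:R ^+ 2))%:E)
    & (forall (d : nat -> measure_display) (T : forall n, measurableType (d n))
         (P : forall n, probability (T n) R)
         (B : forall n, nat -> {RV (P n) >-> nat}),
         (forall n, (2 <= n)%N -> iid_uniform_digits b n (P n) (B n)) ->
         converges_in_distribution P
           (fun n => standardized (P n) (total_descents (B n) n))
           (normal_prob 0 1))].
Proof.
have b_gt0 : (0 < b)%N by exact: ltnW.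
split.
- move=> n d T P A _ /iid_uniform_letters uA; split.
    exact/(uniform_letters_iid b_ge2)/(uniform_remainders b_ge2).
  apply: filterS (ae_letters b_ge2 uA) => w; exact: carries_descents.
- move=> n d T P B n_ge2 /iid_uniform_letters uB; split.
    exact: expectation_total_descents.
  exact: variance_total_descents.
- move=> d T P B iidB x _; rewrite [X in _ --> X](normal_cdfE x).
  apply: cvg_EFin.
    by apply: nearW => n; rewrite fin_num_measure.
  (* The digits are constrained only for [n >= 2], so the two functions are identified
     eventually. *)
  apply: (cvg_trans _ (cvg_descents_cdf b_ge2 (x := x))); apply: near_eq_cvg.
  near=> n; have n_ge2 : (2 <= n)%N by near: n; exact: nbhs_infty_ge.
  have uB := iid_uniform_letters (iidB n n_ge2).
  rewrite /= (cdf_standardized_descents b_ge2 uB n_ge2 x) /=.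
  by rewrite /descents_cdf prednK// ltnW.
Unshelve. all: by end_near. Qed.
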